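(* Let $\alpha\ge0$. If $f(z)=z^{-1}+\sum_{n=0}^{\infty}a_nz^n$ belongs to $ME(\alpha)$, then $$|a_n|\le\frac{2}{\sqrt{\alpha^2(n+1)^2+1}+\alpha(n+1)}\qquad\text{for all } n\ge0.$$ The result is sharp: for each $n\ge 1$, with $d_n=\sqrt{\alpha^2n^2+1}-\alpha n$, the function $f$ defined by $zf(z)=\frac{1+d_nz^n}{1-d_nz^n}$ belongs to $ME(\alpha)$ and attains equality in the bound for the coefficient $a_{n-1}$.
   Context: Let $E=\{z\in\mathbb{C}: 0<|z|<1\}$. Let $\Sigma$ be the family of functions $f(z)=z^{-1}+\sum_{n=0}^{\infty}a_nz^n$ ($a_n\in\mathbb{C}$) that are analytic in $E$, with a simple pole at $z=0$. For $0\le\alpha$, $ME(\alpha)$ is the set of $f\in\Sigma$ such that $\operatorname{Re}(zf(z))>\alpha\,|z^2f'(z)+zf(z)|$ for all $z\in E$. *)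

(* Defs.v *)
From Stdlib Require Import Reals.
From Coquelicot Require Export Coquelicot.

Open Scope R_scope.

Definition E (z : C) : Prop := 0 < Cmod z < 1.

(* Complex (not real) differentiability: the scalar field is [C_AbsRing]. *)
Definition analytic_in_E (f : C -> C) : Prop :=
  forall z : C, E z -> ex_derive (K := C_AbsRing) (V := C_NormedModule) f z.

(* f(z) = z^-1 + sum_{n >= 0} a_n z^n, convergent at every point of E. *)
Definition has_expansion (f : C -> C) (a : nat -> C) : Prop :=
  forall z : C, E z ->
    is_pseries (K := C_AbsRing) (V := C_NormedModule) a z (f z - / z)%C.

(* The simple pole at 0 is the [/ z] term of the expansion.  Values of [f]
   outside E are irrelevant. *)
Definition Sigma (f : C -> C) : Prop :=
  analytic_in_E f /\ exists a : nat -> C, has_expansion f a.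

(* [C_derive] is a total operator whose value is meaningful only where [f] is
   differentiable; this holds on E since [Sigma f] is required. *)
Definition ME (alpha : R) (f : C -> C) : Prop :=
  Sigma f /\
  forall z : C, E z ->
    Re (z * f z)%C > alpha * Cmod (z ^ 2 * C_derive f z + z * f z)%C.

Definition coef_bound (alpha : R) (n : nat) : R :=
  2 / (sqrt (alpha ^ 2 * (INR n + 1) ^ 2 + 1) + alpha * (INR n + 1)).

Definition d (alpha : R) (n : nat) : R :=
  sqrt (alpha ^ 2 * INR n ^ 2 + 1) - alpha * INR n.

(* Main.v *)
(** Write p(z) = z f(z) = 1 + sum_k c_k z^k with c_k = a_(k-1); the condition
    defining ME(alpha) reads Re p > alpha |z p'|.  For d >= 0, |eps| = 1 and
    |w| = 1 the weight phi = |1 - d eps w^k|^2 is the modulus of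
    psi = conj(w)^k (1 - d eps w^k)^2, so the circle mean of phi Re p is at
    least alpha times the modulus of the mean of psi z p'.  Only c_0 and c_k
    survive in these means, and for the right eps one gets, as the radius tends
    to 1, 1 + d^2 - d |c_k| >= alpha k |c_k|.  The choice d = d_k, for which
    d^2 + 2 alpha k d = 1, turns this into |c_k| <= 2 d_k.  Circle means are
    taken over roots of unity, whose number then tends to infinity; they also
    give the uniqueness of the coefficients needed for sharpness. *)

Require Import Defs.
From Stdlib Require Import Reals Lra Lia Arith.
From Coquelicot Require Import Coquelicot.

(** * Complex series and the radius of convergence *)

Lemma pow_n_Cpow (z : C) (n : nat) : pow_n (K := C_AbsRing) z n = (z ^ n)%C.
Proof. induction n as [|n IH]; [reflexivity|]. simpl; now rewrite IH. Qed.

Lemma is_pseries_C (a : nat -> C) (z l : C) :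
  is_pseries (K := C_AbsRing) (V := C_NormedModule) a z l <->
  is_series (K := C_AbsRing) (V := C_NormedModule) (fun n => a n * z ^ n)%C l.
Proof.
  assert (H : forall n, scal (V := C_NormedModule) (pow_n (K := C_AbsRing) z n) (a n) = (a n * z ^ n)%C)
    by (intros n; rewrite pow_n_Cpow; exact (Cmult_comm _ _)).
  unfold is_pseries; split; apply is_series_ext; intros n; [|symmetry]; apply H.
Qed.

Lemma is_series_C_unique (a : nat -> C) (l1 l2 : C) :
  is_series (K := C_AbsRing) (V := C_NormedModule) a l1 ->
  is_series (K := C_AbsRing) (V := C_NormedModule) a l2 -> l1 = l2.
Proof.
  intros H1 H2.
  exact (filterlim_locally_unique (K := C_AbsRing) (V := C_NormedModule) _ _ _ H1 H2).
Qed.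

Lemma Cmod_series_le (a : nat -> C) (b : nat -> R) (l : C) (S : R) :
  (forall n, Cmod (a n) <= b n) ->
  is_series (K := C_AbsRing) (V := C_NormedModule) a l -> is_series b S -> Cmod l <= S.
Proof.
  intros Hab Ha Hb.
  assert (H1 : is_lim_seq (fun n => Cmod (sum_n (G := C_AbelianMonoid) a n)) (Cmod l)).
  { eapply filterlim_comp; [exact Ha|].
    exact (filterlim_norm (K := C_AbsRing) (V := C_NormedModule) l). }
  assert (H2 : is_lim_seq (sum_n b) S) by exact Hb.
  refine (is_lim_seq_le _ _ _ _ _ H1 H2).
  intros n.
  eapply Rle_trans.
  - exact (norm_sum_n_m (K := C_AbsRing) (V := C_NormedModule) a 0 n).
  - apply sum_n_m_le. exact Hab.
Qed.

Lemma ex_series_C_abs (a : nat -> C) :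
  ex_series (fun n => Cmod (a n)) -> ex_series (K := C_AbsRing) (V := C_NormedModule) a.
Proof.
  intros H.
  apply (ex_series_le (K := C_AbsRing) (V := C_CompleteNormedModule) a (fun n => Cmod (a n))).
  - intros n. apply Rle_refl.
  - exact H.
Qed.

(** Passing to moduli makes the real theory of power series available. At a radius [r] strictly
    between [Rabs s] and 1 the series converges, so its terms tend to 0 and are bounded, which
    forces the radius of convergence to be at least [r]. *)
Lemma CV_radius_Cmod (a : nat -> C) (g : C -> C) :
  (forall z, E z -> is_pseries (K := C_AbsRing) (V := C_NormedModule) a z (g z)) ->
  forall s, Rabs s < 1 -> Rbar_lt (Rabs s) (CV_radius (fun n => Cmod (a n))).
Proof.
  intros H s Hs.
  set (r := (1 + Rabs s) / 2).
  assert (Hs0 := Rabs_pos s).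
  assert (Hr : 0 < r < 1 /\ Rabs s < r) by (unfold r; lra).
  apply Rbar_lt_le_trans with r; [simpl; lra|].
  apply (CV_radius_bounded (fun n => Cmod (a n))).
  assert (HE : E (RtoC r)) by (unfold E; rewrite Cmod_R, Rabs_pos_eq; lra).
  assert (H1 := proj1 (is_pseries_C _ _ _) (H _ HE)).
  assert (H2 : is_lim_seq (fun n => Cmod (a n * RtoC r ^ n)%C) 0).
  { assert (H3 : ex_series (K := C_AbsRing) (V := C_CompleteNormedModule) (fun n => a n * RtoC r ^ n)%C)
      by (eexists; exact H1).
    apply Cauchy_ex_series in H3.
    apply is_lim_seq_spec; intros eps. destruct (H3 eps) as [N HN].
    exists N; intros n Hn. specialize (HN n n Hn Hn).
    rewrite sum_n_n in HN.
    rewrite Rminus_0_r, Rabs_pos_eq by apply Cmod_ge_0. exact HN. }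
  destruct (ex_intro (fun l => Un_cv _ l) 0 (proj1 (is_lim_seq_Reals _ _) H2)) as [l Hl].
  destruct (maj_by_pos _ (exist _ l Hl)) as [M [_ HM]].
  exists M; intros n. eapply Rle_trans; [|apply (HM n)].
  right. rewrite Cmod_mult, Cmod_pow, Cmod_R, (Rabs_pos_eq r) by lra.
  rewrite (Rabs_pos_eq (_ * _)); [|apply Rmult_le_pos; [apply Cmod_ge_0|apply pow_le; lra]].
  reflexivity.
Qed.

(** * Termwise complex differentiation of power series *)

(** A quadratic remainder is o(|y - z|): within distance eps / (|K| + 1) it is at most eps |y - z|.
    The denominator |K| + 1 is positive whatever the value of [K]. *)
Lemma is_derive_C_quadratic (g : C -> C) (z l : C) (K delta : R) :
  0 < delta ->
  (forall y, Cmod (y - z) < delta ->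
     Cmod (g y - g z - (y - z) * l)%C <= K * Cmod (y - z) ^ 2) ->
  is_derive (K := C_AbsRing) (V := C_NormedModule) g z l.
Proof.
  intros Hd H; split; [apply is_linear_scal_l|].
  intros x Hx.
  assert (Hxz : x = z)
   by (symmetry; exact (is_filter_lim_locally_unique (K := C_AbsRing) (V := AbsRing_NormedModule C_AbsRing) _ _ Hx)).
  subst x. intros eps.
  assert (HK : 0 < Rabs K + 1) by (pose proof (Rabs_pos K); lra).
  assert (Hm : 0 < Rmin delta (eps / (Rabs K + 1))).
  { apply Rmin_pos; [easy|]. apply Rdiv_lt_0_compat; [apply cond_pos|easy]. }
  exists (mkposreal _ Hm). intros y Hy.
  change (Cmod (y - z)%C < Rmin delta (eps / (Rabs K + 1))) in Hy.
  change (Cmod (g y - g z - (y - z) * l)%C <= eps * Cmod (y - z)%C).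
  eapply Rle_trans; [apply H|].
  - eapply Rlt_le_trans; [exact Hy|apply Rmin_l].
  - assert (H1 : Cmod (y - z)%C < eps / (Rabs K + 1))
      by (eapply Rlt_le_trans; [exact Hy|apply Rmin_r]).
    apply Rlt_div_r in H1; [|easy].
    pose proof (Rle_abs K). pose proof (Cmod_ge_0 (y - z)%C).
    set (t := Cmod (y - z)%C) in *. nra.
Qed.

(** Induction on the exponent m = n + 2: the remainder of degree m + 1 is y times that of degree m,
    plus m z^(m-1) (y - z)^2. The constants m (m - 1) s^(m-2) are those of the twice differentiated
    series, so they can be summed against the coefficients. *)
Lemma Cpow_taylor_bound (y z : C) (s : R) (n : nat) :
  Cmod y <= s -> Cmod z <= s ->
  Cmod (y ^ S (S n) - z ^ S (S n) - (y - z) * (INR (S (S n)) * z ^ S n))%C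
    <= INR (S n) * INR (S (S n)) * s ^ n * Cmod (y - z) ^ 2.
Proof.
  intros Hy Hz.
  pose proof (Cmod_ge_0 y). pose proof (Cmod_ge_0 z).
  induction n as [|n IH].
  - replace (_ - _ - _)%C with ((y - z) * (y - z))%C by (simpl; rewrite RtoC_plus; ring).
    rewrite Cmod_mult. simpl. pose proof (Cmod_ge_0 (y - z)%C). nra.
  - replace (_ - _ - _)%C with
      (y * (y ^ S (S n) - z ^ S (S n) - (y - z) * (INR (S (S n)) * z ^ S n))
       + INR (S (S n)) * z ^ S n * ((y - z) * (y - z)))%C
      by (rewrite (S_INR (S (S n))), RtoC_plus; simpl Cpow; ring).
    eapply Rle_trans; [apply Cmod_triangle|].
    rewrite !Cmod_mult, Cmod_pow, Cmod_R, (Rabs_pos_eq (INR _)) by apply pos_INR.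
    assert (Hp : Cmod z ^ S n <= s ^ S n) by (apply pow_incr; lra).
    assert (Hs : 0 <= s ^ S n) by (apply pow_le; lra).
    pose proof (Cmod_ge_0 (y - z)%C) as Ht.
    set (t := Cmod (y - z)%C) in *.
    pose proof (pos_INR (S n)).
    assert (Ha : INR (S (S n)) = INR (S n) + 1) by apply S_INR.
    assert (Hb : INR (S (S (S n))) = INR (S n) + 2) by (rewrite !S_INR; ring).
    rewrite Ha, Hb in *. set (k := INR (S n)) in *.
    assert (Ht2 : 0 <= t * t) by nra.
    apply Rle_trans with (s * (k * (k + 1) * s ^ n * t ^ 2) + (k + 1) * s ^ S n * (t * t)).
    + apply Rplus_le_compat.
      * apply Rmult_le_compat; auto using Cmod_ge_0.
      * apply Rmult_le_compat_r; [easy|]. apply Rmult_le_compat_l; [lra|easy].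
    + replace (s * _) with (k * (k + 1) * (s ^ S n * (t * t))) by (simpl; ring).
      replace ((k + 1) * (k + 2) * s ^ S n * t ^ 2) with ((k + 1) * (k + 2) * (s ^ S n * (t * t))) by ring.
      rewrite Rmult_assoc.
      assert (0 <= s ^ S n * (t * t)) by now apply Rmult_le_pos.
      nra.
Qed.

(** Up to an index shift, these are [s] times the terms of the derived series, which has the same
    radius of convergence. *)
Lemma ex_series_derive_weight (A : nat -> R) (s : R) :
  Rbar_lt (Rabs s) (CV_radius A) ->
  ex_series (fun n => Rabs (INR n * A n * s ^ n)).
Proof.
  intros H.
  apply ex_series_incr_1.
  apply (ex_series_ext (fun n => Rabs s * Rabs (PS_derive A n * s ^ n))).
  - intros n. unfold PS_derive. rewrite <- Rabs_mult. f_equal. simpl pow. ring.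
  - apply (ex_series_scal (V := R_NormedModule)). apply CV_disk_inside. now rewrite CV_radius_derive.
Qed.

(** The Taylor remainders of the monomials are summed at a radius [s] between |z| and 1, giving a
    quadratic remainder for [g]. Stating the series for [z * l] instead of [l] avoids an index
    shift. *)
Lemma is_pseries_C_derive (c : nat -> C) (g : C -> C) :
  (forall z, E z -> is_pseries (K := C_AbsRing) (V := C_NormedModule) c z (g z)) ->
  forall z, E z -> exists l,
    is_derive (K := C_AbsRing) (V := C_NormedModule) g z l /\
    is_pseries (K := C_AbsRing) (V := C_NormedModule) (fun n => INR n * c n)%C z (z * l)%C.
Proof.
  intros H z Hz.
  assert (Hz0 : z <> 0%C) by (apply Cmod_gt_0; apply Hz).
  set (s := (1 + Cmod z) / 2).
  assert (Hs : Cmod z < s < 1) by (destruct Hz; unfold s; lra).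
  pose proof (Cmod_ge_0 z) as Hz1.
  assert (Hex : exists m : C,
    is_series (K := C_AbsRing) (V := C_NormedModule) (fun n => INR n * c n * z ^ n)%C m).
  { apply ex_series_C_abs.
    apply (ex_series_ext (fun n => Rabs (INR n * Cmod (c n) * Cmod z ^ n))).
    - intros n. rewrite !Cmod_mult, Cmod_pow, Cmod_R, !Rabs_mult, (Rabs_pos_eq (Cmod _)) by apply Cmod_ge_0.
      rewrite (Rabs_pos_eq (_ ^ _)); [reflexivity|now apply pow_le].
    - apply ex_series_derive_weight, (CV_radius_Cmod c g H).
      rewrite Rabs_pos_eq; lra. }
  destruct Hex as [m Hm].
  exists (m / z)%C. split.
  2: { apply is_pseries_C. replace (z * (m / z))%C with m by (field; easy). exact Hm. }
  assert (HK : ex_series (fun n => INR (S n) * INR (S (S n)) * s ^ n * Cmod (c (S (S n))))).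
  { apply (ex_series_ext (fun n => Rabs (PS_derive (PS_derive (fun n => Cmod (c n))) n * s ^ n))).
    - intros n. unfold PS_derive. rewrite Rabs_pos_eq; [match goal with |- ?a = ?b => change (@eq R a b) end; ring|].
      repeat apply Rmult_le_pos; auto using pos_INR, Cmod_ge_0. apply pow_le; lra.
    - apply CV_disk_inside. rewrite !CV_radius_derive. apply (CV_radius_Cmod c g H).
      rewrite Rabs_pos_eq; lra. }
  destruct HK as [K HK].
  (* This radius keeps [y] away from 0 and within |y| <= s, so [y] stays in [E]. *)
  apply is_derive_C_quadratic with K (Rmin (s - Cmod z) (Cmod z)).
  { apply Rmin_pos; [lra|apply Hz]. }
  intros y Hy.
  assert (Hy1 : Cmod (y - z) < s - Cmod z) by (eapply Rlt_le_trans; [exact Hy|apply Rmin_l]).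
  assert (Hy2 : Cmod (y - z) < Cmod z) by (eapply Rlt_le_trans; [exact Hy|apply Rmin_r]).
  assert (Hys : Cmod y <= s).
  { replace y with (y - z + z)%C by ring. pose proof (Cmod_triangle (y - z) z). lra. }
  assert (HyE : E y).
  { split; [|lra]. pose proof (Cmod_triangle y (z - y)) as Ht.
    replace (y + (z - y))%C with z in Ht by ring.
    replace (z - y)%C with (- (y - z))%C in Ht by ring. rewrite Cmod_opp in Ht. lra. }
  pose (e := fun n => (c n * (y ^ n - z ^ n - (y - z) / z * (INR n * z ^ n)))%C).
  assert (He : is_series (K := C_AbsRing) (V := C_NormedModule) e (g y - g z - (y - z) * (m / z))%C).
  { assert (H1 := proj1 (is_pseries_C _ _ _) (H y HyE)).
    assert (H2 := proj1 (is_pseries_C _ _ _) (H z Hz)).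
    assert (H3 := is_series_minus (K := C_AbsRing) (V := C_NormedModule) _ _ _ _
      (is_series_minus (K := C_AbsRing) (V := C_NormedModule) _ _ _ _ H1 H2)
      (is_series_scal (K := C_AbsRing) (V := C_NormedModule) ((y - z) / z)%C _ _ Hm)).
    replace (g y - g z - (y - z) * (m / z))%C with (g y - g z - (y - z) / z * m)%C by (field; easy).
    eapply is_series_ext; [|exact H3].
    intros n. unfold e.
    change (c n * y ^ n - c n * z ^ n - (y - z) / z * (INR n * c n * z ^ n)
       = c n * (y ^ n - z ^ n - (y - z) / z * (INR n * z ^ n)))%C. ring. }
  rewrite Rmult_comm.
  (* The remainders [e 0] and [e 1] vanish, so the estimate starts at degree 2. *)
  apply (Cmod_series_le (fun n => e (S (S n)))
    (fun n => Cmod (y - z) ^ 2 * (INR (S n) * INR (S (S n)) * s ^ n * Cmod (c (S (S n)))))).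
  - intros n. unfold e. rewrite Cmod_mult.
    replace ((y - z) / z * (INR (S (S n)) * z ^ S (S n)))%C
      with ((y - z) * (INR (S (S n)) * z ^ S n))%C by (rewrite (Cpow_S z (S n)); field; easy).
    rewrite Rmult_comm, <- Rmult_assoc, (Rmult_comm (Cmod (y - z) ^ 2)).
    apply Rmult_le_compat_r; [apply Cmod_ge_0|].
    apply Cpow_taylor_bound; lra.
  - apply (is_series_incr_1 (K := C_AbsRing) (V := C_NormedModule) (fun n => e (S n))).
    apply (is_series_incr_1 (K := C_AbsRing) (V := C_NormedModule) e).
    set (L := (g y - g z - (y - z) * (m / z))%C) in *.
    change (is_series (K := C_AbsRing) (V := C_NormedModule) e (L + e 1%nat + e 0%nat)%C).
    replace (L + e 1%nat + e 0%nat)%C with L; [exact He|].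
    unfold e. simpl. field; easy.
  - exact (is_series_scal (V := R_NormedModule) _ _ _ HK).
Qed.

(** * Means over roots of unity *)

Definition cis (t : R) : C := (cos t, sin t).

Lemma cis_plus (s t : R) : cis (s + t) = (cis s * cis t)%C.
Proof. unfold cis, Cmult; simpl. rewrite cos_plus, sin_plus. f_equal; ring. Qed.

Lemma cis_0 : cis 0 = 1%C.
Proof. unfold cis. now rewrite cos_0, sin_0. Qed.

Lemma cis_pow (t : R) (n : nat) : (cis t ^ n)%C = cis (INR n * t).
Proof.
  induction n as [|n IH].
  - simpl. rewrite Rmult_0_l. now rewrite cis_0.
  - rewrite Cpow_S, IH, S_INR, <- cis_plus. f_equal; ring.
Qed.

Lemma Cmod_cis (t : R) : Cmod (cis t) = 1.
Proof.
  unfold Cmod, cis, fst, snd. rewrite <- !Rsqr_pow2, Rplus_comm, sin2_cos2. apply sqrt_1.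
Qed.

Lemma cis_2PI (n : nat) : cis (INR n * (2 * PI)) = 1%C.
Proof.
  rewrite <- cis_pow. unfold cis at 1. rewrite cos_2PI, sin_2PI. apply Cpow_1_l.
Qed.

Lemma cis_neq_1 (t : R) : 0 < t < 2 * PI -> cis t <> 1%C.
Proof.
  intros Ht H. injection H as Hc _.
  replace t with (2 * (t / 2)) in Hc by field.
  rewrite cos_2a_sin in Hc.
  assert (0 < sin (t / 2)) by (apply sin_gt_0; lra). nra.
Qed.

Lemma Cmult_conj_unit (w : C) : Cmod w = 1 -> (w * Cconj w)%C = 1%C.
Proof. intros H. rewrite <- Cmod2_conj, H. f_equal. ring. Qed.

Definition angle (N m : nat) : R := 2 * PI * INR m / (INR N + 1).

(* [N + 1] points rather than [N], because [sum_n] has an inclusive upper bound. *)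
Definition mean (N : nat) (F : C -> C) : C :=
  (/ RtoC (INR N + 1) * sum_n (G := C_AbelianMonoid) (fun m => F (cis (angle N m))) N)%C.

Lemma INR_plus_1_neq_0 (N : nat) : RtoC (INR N + 1) <> 0%C.
Proof. intros H. apply RtoC_inj in H. pose proof (pos_INR N). lra. Qed.

Lemma mean_ext (N : nat) (F G : C -> C) :
  (forall w, Cmod w = 1 -> F w = G w) -> mean N F = mean N G.
Proof.
  intros H. unfold mean. f_equal. apply sum_n_ext. intros m. apply H, Cmod_cis.
Qed.

Lemma mean_plus (N : nat) (F G : C -> C) :
  mean N (fun w => F w + G w)%C = (mean N F + mean N G)%C.
Proof.
  unfold mean. rewrite <- Cmult_plus_distr_l. f_equal.
  exact (sum_n_plus (G := C_AbelianMonoid) _ _ N).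
Qed.

Lemma mean_scal (N : nat) (k : C) (F : C -> C) :
  mean N (fun w => k * F w)%C = (k * mean N F)%C.
Proof.
  unfold mean. rewrite Cmult_assoc, (Cmult_comm k), <- Cmult_assoc. f_equal.
  exact (sum_n_mult_l (K := C_Ring) k _ N).
Qed.

(** The triangle inequality. The majorant is the real part of a complex function, so that both sides
    are means to which the same linearity rules apply. *)
Lemma Cmod_mean_le (N : nat) (F : C -> C) (G : C -> C) :
  (forall w, Cmod w = 1 -> Cmod (F w) <= Re (G w)) -> Cmod (mean N F) <= Re (mean N G).
Proof.
  intros H. unfold mean.
  rewrite <- RtoC_inv, re_scal_l, Cmod_mult, Cmod_R by (pose proof (pos_INR N); lra).
  assert (H0 : 0 < / (INR N + 1)) by (apply Rinv_0_lt_compat; pose proof (pos_INR N); lra).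
  rewrite Rabs_pos_eq by lra.
  apply Rmult_le_compat_l; [lra|].
  (* Only the upper limits of the sums vary in the induction; the sample points stay those for
     [N]. *)
  generalize N at 2 4. intros n. induction n as [|n IH].
  - rewrite !sum_O. apply H, Cmod_cis.
  - rewrite !sum_Sn.
    change (Cmod (sum_n (G := C_AbelianMonoid) (fun m => F (cis (angle N m))) n + F (cis (angle N (S n)))) <=
     Re (sum_n (G := C_AbelianMonoid) (fun m => G (cis (angle N m))) n + G (cis (angle N (S n))))).
    rewrite re_plus. eapply Rle_trans; [apply Cmod_triangle|].
    apply Rplus_le_compat; [exact IH|apply H, Cmod_cis].
Qed.

Lemma mean_const (N : nat) (k : C) : mean N (fun _ => k) = k.
Proof.
  unfold mean.
  assert (H : forall n, sum_n (G := C_AbelianMonoid) (fun _ => k) n = (RtoC (INR n + 1) * k)%C).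
  { intros n. induction n as [|n IH].
    - rewrite sum_O. simpl. rewrite Rplus_0_l. symmetry; apply Cmult_1_l.
    - rewrite sum_Sn, IH, S_INR.
      change (RtoC (INR n + 1) * k + k = RtoC (INR n + 1 + 1) * k)%C.
      rewrite (RtoC_plus (_ + 1)). ring. }
  rewrite H. field. apply INR_plus_1_neq_0.
Qed.

Lemma geometric_sum (q : C) (n : nat) :
  ((q - 1) * sum_n (G := C_AbelianMonoid) (fun m => q ^ m) n)%C = (q ^ S n - 1)%C.
Proof.
  induction n as [|n IH].
  - rewrite sum_O. simpl. ring.
  - rewrite sum_Sn.
    change ((q - 1) * (sum_n (G := C_AbelianMonoid) (fun m => q ^ m) n + q ^ S n) = q ^ S (S n) - 1)%C.
    rewrite Cmult_plus_distr_l, IH. simpl. ring.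
Qed.

(** Orthogonality of characters. For j <> k the summands are the powers of q = w1^j conj(w1)^k,
    where q^(N+1) = 1 and, since 0 < |j - k| <= N, q <> 1; hence the geometric sum vanishes. The
    bounds on [j] and [k] exclude aliasing. *)
Lemma mean_character (N j k : nat) : (j <= N)%nat -> (k <= N)%nat ->
  mean N (fun w => w ^ j * Cconj w ^ k)%C = if Nat.eq_dec j k then 1%C else 0%C.
Proof.
  intros Hj Hk. destruct (Nat.eq_dec j k) as [<-|Hjk].
  - rewrite <- (mean_const N 1). apply mean_ext. intros w Hw.
    now rewrite <- Cpow_mult_l, Cmult_conj_unit, Cpow_1_l.
  - set (w1 := cis (angle N 1)).
    pose proof (pos_INR N) as HN.
    assert (Hw1 : Cmod w1 = 1) by apply Cmod_cis.
    assert (Hang : forall m, cis (angle N m) = (w1 ^ m)%C).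
    { intros m. unfold w1. rewrite cis_pow. f_equal. unfold angle. simpl. field. lra. }
    assert (Hroot : (w1 ^ S N)%C = 1%C).
    { rewrite <- Hang. rewrite <- (cis_2PI 1). f_equal. unfold angle. rewrite S_INR. simpl. field. lra. }
    set (q := (w1 ^ j * Cconj w1 ^ k)%C).
    assert (Hneq : forall i l, (i < l)%nat -> (l <= N)%nat -> (w1 ^ i)%C <> (w1 ^ l)%C).
    { intros i l Hil Hl He.
      replace l with (i + (l - i))%nat in He by lia.
      rewrite Cpow_add_r in He.
      assert (Hi : (w1 ^ i)%C <> 0%C).
      { apply Cmod_gt_0. rewrite Cmod_pow, Hw1, pow1. lra. }
      assert (He2 : (w1 ^ (l - i))%C = 1%C).
      { replace (w1 ^ (l - i))%C with (w1 ^ i * w1 ^ (l - i) / w1 ^ i)%C by (field; easy).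
        rewrite <- He. field; easy. }
      rewrite <- Hang in He2. revert He2. apply cis_neq_1. unfold angle.
      assert (0 < INR (l - i)) by (apply lt_0_INR; lia).
      assert (INR (l - i) <= INR N) by (apply le_INR; lia).
      pose proof PI_RGT_0.
      split.
      - apply Rdiv_lt_0_compat; [|lra]. apply Rmult_lt_0_compat; lra.
      - apply Rlt_div_l; [lra|]. apply Rmult_lt_compat_l; lra. }
    assert (Hq1 : q <> 1%C).
    { intros Hq.
      assert (He : (w1 ^ j)%C = (w1 ^ k)%C).
      { rewrite <- (Cmult_1_l (w1 ^ k)), <- Hq. unfold q.
        rewrite <- Cmult_assoc, <- Cpow_mult_l, (Cmult_comm (Cconj w1)), Cmult_conj_unit, Cpow_1_l by easy.
        ring. }
      destruct (Nat.lt_gt_cases j k) as [Hlt _]. destruct (Hlt Hjk) as [Hl|Hl].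
      - now apply (Hneq j k).
      - now apply (Hneq k j). }
    assert (Hqr : (q ^ S N)%C = 1%C).
    { unfold q. rewrite Cpow_mult_l, <- !Cpow_mult_r, (Nat.mul_comm j), (Nat.mul_comm k), !Cpow_mult_r.
      rewrite <- Cpow_conj, Hroot, Cpow_1_l.
      assert (H1 : Cconj 1%C = 1%C) by (apply injective_projections; simpl; ring).
      rewrite H1.
      now rewrite Cpow_1_l, Cmult_1_l. }
    assert (Hsum : sum_n (G := C_AbelianMonoid) (fun m => q ^ m)%C N = RtoC 0).
    { assert (Hq0 : (q - 1)%C <> 0%C).
      { intros Hq0. apply Hq1. replace q with (q - 1 + 1)%C by ring. rewrite Hq0. ring. }
      assert (Hcancel : forall T : C, ((q - 1) * T)%C = 0%C -> T = 0%C).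
      { intros T HT. replace T with ((q - 1) * T / (q - 1))%C by (field; easy).
        rewrite HT. field; easy. }
      apply Hcancel. rewrite geometric_sum, Hqr. ring. }
    unfold mean.
    rewrite (sum_n_ext _ (fun m => q ^ m)%C), Hsum; [ring|].
    intros m. rewrite Hang, Cpow_conj. unfold q.
    rewrite Cpow_mult_l, <- !Cpow_mult_r, (Nat.mul_comm j), (Nat.mul_comm k). reflexivity.
Qed.

Lemma mean_polynomial (b : nat -> C) (N M k : nat) : (M <= N)%nat -> (k <= N)%nat ->
  mean N (fun w => sum_n (G := C_AbelianMonoid) (fun j => b j * w ^ j)%C M * Cconj w ^ k)%C =
  if le_dec k M then b k else 0%C.
Proof.
  intros HM Hk. induction M as [|M IH].
  - rewrite (mean_ext _ _ (fun w => b 0%nat * (w ^ 0 * Cconj w ^ k))%C).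
    + rewrite mean_scal, mean_character by lia.
      destruct (Nat.eq_dec 0 k) as [<-|Hk0]; destruct (le_dec _ 0); try lia; ring.
    + intros w _. rewrite sum_O. ring.
  - rewrite (mean_ext _ _ (fun w => sum_n (G := C_AbelianMonoid) (fun j => b j * w ^ j)%C M * Cconj w ^ k
       + b (S M) * (w ^ S M * Cconj w ^ k))%C).
    + rewrite mean_plus, IH, mean_scal, mean_character by lia.
      destruct (Nat.eq_dec (S M) k) as [<-|Hk0]; destruct (le_dec _ M); destruct (le_dec _ (S M));
        try lia; ring.
    + intros w _. rewrite sum_Sn. change plus with Cplus. ring.
Qed.

(** * Coefficients of a power series as limits of means *)

(** Split [F] into its partial sum of degree [N], from which the mean extracts [b k] exactly, and a
    tail bounded uniformly on the circle by the tail of the series of moduli. *)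
Lemma mean_series_coef (b : nat -> C) (F : C -> C) (k : nat) :
  (forall w, Cmod w = 1 ->
     is_series (K := C_AbsRing) (V := C_NormedModule) (fun n => b n * w ^ n)%C (F w)) ->
  ex_series (fun n => Cmod (b n)) ->
  forall eta, 0 < eta -> exists N0, forall N, (N0 <= N)%nat ->
    Cmod (mean N (fun w => F w * Cconj w ^ k) - b k)%C <= eta.
Proof.
  intros HF [L HL] eta Heta.
  assert (HL' : is_lim_seq (sum_n (fun n => Cmod (b n))) L) by exact HL.
  apply is_lim_seq_spec in HL'. destruct (HL' (mkposreal eta Heta)) as [M HM]. simpl in HM.
  exists (M + k)%nat. intros N HN.
  specialize (HM N ltac:(lia)).
  pose (P := fun w => sum_n (G := C_AbelianMonoid) (fun j => b j * w ^ j)%C N).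
  replace (mean N (fun w => F w * Cconj w ^ k) - b k)%C
    with (mean N (fun w => (F w - P w) * Cconj w ^ k)%C).
  - replace eta with (Re (mean N (fun _ => RtoC eta))) by (rewrite mean_const; apply re_RtoC).
    apply Cmod_mean_le. intros w Hw.
    rewrite re_RtoC, Cmod_mult, Cmod_pow, Cmod_conj, Hw, pow1, Rmult_1_r.
    apply Rle_trans with (L - sum_n (fun n => Cmod (b n)) N).
    + apply (Cmod_series_le (fun n => b (S N + n)%nat * w ^ (S N + n))%C (fun n => Cmod (b (S N + n)%nat))).
      * intros n. rewrite Cmod_mult, Cmod_pow, Hw, pow1. lra.
      * apply (is_series_incr_n (K := C_AbsRing) (V := C_NormedModule) (fun n => b n * w ^ n)%C); [lia|].
        change (is_series (K := C_AbsRing) (V := C_NormedModule) (fun n => b n * w ^ n)%C (F w - P w + P w)%C).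
        replace (F w - P w + P w)%C with (F w) by ring. now apply HF.
      * apply (is_series_incr_n (fun n => Cmod (b n))); [lia|].
        set (s := sum_n _ _). change (is_series (fun n => Cmod (b n)) (L - s + s)).
        replace (L - s + s) with L; [exact HL|]. unfold Rminus.
        rewrite Rplus_assoc, Rplus_opp_l. symmetry; apply Rplus_0_r.
    + apply Rabs_lt_between in HM. lra.
  - rewrite (mean_ext _ _ (fun w => F w * Cconj w ^ k + (-1) * (P w * Cconj w ^ k))%C)
      by (intros w _; ring).
    rewrite mean_plus, mean_scal. unfold P. rewrite mean_polynomial by lia.
    destruct (le_dec k N); [ring|lia].
Qed.

(* Multiplication by [w ^ k] shifts the series, which then has no constant term. *)
Lemma mean_series_mul_pow (b : nat -> C) (F : C -> C) (k : nat) :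
  (forall w, Cmod w = 1 ->
     is_series (K := C_AbsRing) (V := C_NormedModule) (fun n => b n * w ^ n)%C (F w)) ->
  ex_series (fun n => Cmod (b n)) -> (1 <= k)%nat ->
  forall eta, 0 < eta -> exists N0, forall N, (N0 <= N)%nat ->
    Cmod (mean N (fun w => F w * w ^ k)%C) <= eta.
Proof.
  intros HF Hb Hk eta Heta.
  pose (b' := PS_incr_n (V := C_NormedModule) b k).
  destruct (mean_series_coef b' (fun w => F w * w ^ k)%C 0) with (eta := eta) as [N0 HN0].
  - intros w Hw. apply is_pseries_C.
    replace (F w * w ^ k)%C with (scal (V := C_NormedModule) (pow_n (K := C_AbsRing) w k) (F w : C))
      by (rewrite pow_n_Cpow; exact (Cmult_comm _ _)).
    apply (is_pseries_incr_n (K := C_AbsRing) (V := C_NormedModule)). apply is_pseries_C. now apply HF.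
  - apply (ex_series_incr_n (fun n => Cmod (b' n)) k).
    apply (ex_series_ext (fun n => Cmod (b n))); [|exact Hb].
    intros n. unfold b'. rewrite PS_incr_n_simplify.
    destruct (le_lt_dec k (k + n)); [|lia]. now replace (k + n - k)%nat with n by lia.
  - exact Heta.
  - exists N0. intros N HN. specialize (HN0 N HN).
    replace (mean N (fun w => F w * w ^ k)%C)
      with (mean N (fun w => F w * w ^ k * Cconj w ^ 0) - b' 0%nat)%C; [exact HN0|].
    replace (b' 0%nat) with (RtoC 0).
    + rewrite (mean_ext N _ (fun w => F w * w ^ k)%C); [ring|]. intros w _. simpl. ring.
    + unfold b'. rewrite PS_incr_n_simplify. destruct (le_lt_dec k 0); [lia|reflexivity].
Qed.

(** * The weighted mean inequality for one coefficient *)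

(** The radius is absorbed into [b], so [F] and [G] play the roles of p and z p' on a circle inside
    the disc. Were the inequality to fail by [gap], finite means close enough to their limits would
    contradict the comparison of weighted means. *)
Lemma coef_test_inequality (alpha d : R) (b : nat -> C) (F G : C -> C) (k : nat) :
  0 <= alpha -> 0 <= d -> (1 <= k)%nat -> b 0%nat = 1%C ->
  (forall w, Cmod w = 1 ->
     is_series (K := C_AbsRing) (V := C_NormedModule) (fun n => b n * w ^ n)%C (F w)) ->
  (forall w, Cmod w = 1 ->
     is_series (K := C_AbsRing) (V := C_NormedModule) (fun n => INR n * b n * w ^ n)%C (G w)) ->
  ex_series (fun n => Cmod (b n)) -> ex_series (fun n => Cmod (INR n * b n)%C) ->
  (forall w, Cmod w = 1 -> alpha * Cmod (G w) <= Re (F w)) ->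
  Cmod (b k) * (alpha * INR k + d) <= 1 + d ^ 2.
Proof.
  intros Ha Hd Hk Hb0 HF HG HbF HbG Hineq.
  (* [eps] is the phase of [b k], and may be 1 when [b k] is 0. *)
  assert (Heps : exists eps : C, Cmod eps = 1 /\ (Cconj eps * b k)%C = RtoC (Cmod (b k))).
  { destruct (Req_dec (Cmod (b k)) 0) as [H0|H0].
    - exists 1%C. split; [apply Cmod_1|]. rewrite H0, (Cmod_eq_0 _ H0). ring.
    - assert (H1 : RtoC (Cmod (b k)) <> 0%C) by (intros H; apply H0; now apply RtoC_inj).
      exists (b k / Cmod (b k))%C. split.
      + rewrite Cmod_div, Cmod_R, Rabs_pos_eq by (auto using Cmod_ge_0). field; easy.
      + rewrite Cdiv_conj by easy.
        assert (Hc : Cconj (RtoC (Cmod (b k))) = RtoC (Cmod (b k)))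
          by (apply injective_projections; simpl; ring).
        rewrite Hc.
        replace (Cconj (b k) / Cmod (b k) * b k)%C with ((b k * Cconj (b k)) / Cmod (b k))%C by (field; easy).
        rewrite <- Cmod2_conj. rewrite RtoC_pow. field; easy. }
  destruct Heps as [eps [Heps1 Heps2]].
  set (B := Cmod (b k)) in *.
  apply Rnot_lt_le. intros Hlt.
  set (gap := B * (alpha * INR k + d) - (1 + d ^ 2)).
  (* The weights of the three means on each side have moduli adding up to 1 + d^2 + 2 d, with an
     extra factor [alpha] on the side of [G]. The total error is thus at most W eta = gap / 2. *)
  set (W := (1 + d ^ 2 + 2 * d) * (1 + alpha)).
  assert (HW : 0 < W) by (unfold W; nra).
  assert (Hgap : 0 < gap) by (unfold gap; lra).
  set (eta := gap / (2 * W)).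
  assert (Heta : 0 < eta) by (apply Rdiv_lt_0_compat; lra).
  destruct (mean_series_coef b F 0 HF HbF eta Heta) as [N1 H1].
  destruct (mean_series_coef b F k HF HbF eta Heta) as [N2 H2].
  destruct (mean_series_mul_pow b F k HF HbF Hk eta Heta) as [N3 H3].
  destruct (mean_series_coef _ G 0 HG HbG eta Heta) as [N4 H4].
  destruct (mean_series_coef _ G k HG HbG eta Heta) as [N5 H5].
  destruct (mean_series_mul_pow _ G k HG HbG Hk eta Heta) as [N6 H6].
  set (N := (N1 + N2 + N3 + N4 + N5 + N6)%nat).
  specialize (H1 N ltac:(lia)). specialize (H2 N ltac:(lia)). specialize (H3 N ltac:(lia)).
  specialize (H4 N ltac:(lia)). specialize (H5 N ltac:(lia)). specialize (H6 N ltac:(lia)).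
  rewrite Hb0 in H1.
  set (m1 := mean N (fun w => F w * Cconj w ^ 0)%C) in *.
  set (m2 := mean N (fun w => F w * Cconj w ^ k)%C) in *.
  set (m3 := mean N (fun w => F w * w ^ k)%C) in *.
  set (m4 := mean N (fun w => G w * Cconj w ^ 0)%C) in *.
  set (m5 := mean N (fun w => G w * Cconj w ^ k)%C) in *.
  set (m6 := mean N (fun w => G w * w ^ k)%C) in *.
  (* On the circle, phi = 1 + d^2 - d conj(eps) conj(w)^k - d eps w^k. *)
  assert (HmF : mean N (fun w => RtoC (Cmod (1 - d * eps * w ^ k)%C ^ 2) * F w)%C
    = ((1 + d ^ 2) * m1 + (- (d * Cconj eps)) * m2 + (- (d * eps)) * m3)%C).
  { unfold m1, m2, m3. rewrite <- !mean_scal, <- !mean_plus. apply mean_ext. intros w Hw.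
    rewrite Cmod2_conj, Cminus_conj, !Cmult_conj, Cpow_conj.
    assert (Hd' : Cconj (RtoC d) = RtoC d) by (apply injective_projections; simpl; ring).
    assert (H1' : Cconj (RtoC 1) = RtoC 1) by (apply injective_projections; simpl; ring).
    rewrite Hd', H1'.
    assert (Hw' : (w ^ k * Cconj w ^ k)%C = 1%C)
      by (now rewrite <- Cpow_mult_l, Cmult_conj_unit, Cpow_1_l).
    assert (He' := Cmult_conj_unit eps Heps1).
    simpl (Cconj w ^ 0)%C.
    replace ((1 - d * eps * w ^ k) * (1 - d * Cconj eps * Cconj w ^ k) * F w)%C
      with (((1 + d ^ 2 * (eps * Cconj eps) * (w ^ k * Cconj w ^ k))
        - d * Cconj eps * Cconj w ^ k - d * eps * w ^ k) * F w)%C by ring.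
    rewrite He', Hw'. ring. }
  (* On the circle, psi = conj(w)^k - 2 d eps + d^2 eps^2 w^k. *)
  assert (HmG : mean N (fun w => alpha * ((1 - d * eps * w ^ k) ^ 2 * Cconj w ^ k * G w))%C
    = (alpha * (m5 + (- 2 * d * eps) * m4 + (d ^ 2 * eps ^ 2) * m6))%C).
  { rewrite mean_scal. f_equal.
    unfold m4, m5, m6. rewrite <- !mean_scal, <- !mean_plus. apply mean_ext. intros w Hw.
    assert (Hw' : (w ^ k * Cconj w ^ k)%C = 1%C)
      by (now rewrite <- Cpow_mult_l, Cmult_conj_unit, Cpow_1_l).
    simpl (Cconj w ^ 0)%C.
    replace ((1 - d * eps * w ^ k) ^ 2 * Cconj w ^ k * G w)%C
      with ((Cconj w ^ k - 2 * d * eps * (w ^ k * Cconj w ^ k)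
         + d ^ 2 * eps ^ 2 * w ^ k * (w ^ k * Cconj w ^ k)) * G w)%C by ring.
    rewrite Hw'. ring. }
  (* Pointwise, alpha |psi G| = phi alpha |G| <= phi Re F. *)
  assert (Hmean : Cmod (alpha * (m5 + (- 2 * d * eps) * m4 + (d ^ 2 * eps ^ 2) * m6))%C
     <= Re ((1 + d ^ 2) * m1 + (- (d * Cconj eps)) * m2 + (- (d * eps)) * m3)%C).
  { rewrite <- HmF, <- HmG. apply Cmod_mean_le. intros w Hw.
    rewrite re_scal_l, !Cmod_mult, !Cmod_pow, Cmod_conj, Hw, pow1, Cmod_R, (Rabs_pos_eq alpha) by easy.
    rewrite Rmult_1_r, <- Rmult_assoc, (Rmult_comm alpha), Rmult_assoc.
    apply Rmult_le_compat_l; [apply pow2_ge_0|now apply Hineq]. }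
  (* In the limit only k b_k remains: the constant coefficient of [G] is 0 b_0 = 0, and [m6] tends
     to 0. *)
  assert (HL : alpha * INR k * B - alpha * (1 + 2 * d + d ^ 2) * eta <=
     Cmod (alpha * (m5 + (- 2 * d * eps) * m4 + (d ^ 2 * eps ^ 2) * m6))%C).
  { rewrite Cmod_mult, Cmod_R, (Rabs_pos_eq alpha) by easy.
    replace (alpha * INR k * B - alpha * (1 + 2 * d + d ^ 2) * eta)
      with (alpha * (INR k * B - (1 + 2 * d + d ^ 2) * eta)) by ring.
    apply Rmult_le_compat_l; [easy|].
    set (e := ((m5 - INR k * b k) + (- 2 * d * eps) * (m4 - INR 0 * b 0%nat) + (d ^ 2 * eps ^ 2) * m6)%C).
    set (X := (m5 + _ + _)%C).
    assert (HX : (INR k * b k)%C = (X - e)%C) by (unfold X, e; simpl; ring).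
    assert (He : Cmod e <= (1 + 2 * d + d ^ 2) * eta).
    { unfold e. eapply Rle_trans; [apply Cmod_triangle|].
      eapply Rle_trans; [apply Rplus_le_compat_r, Cmod_triangle|].
      rewrite (Cmod_mult (- 2 * d * eps)), (Cmod_mult (d ^ 2 * eps ^ 2)).
      rewrite !Cmod_mult, !Cmod_pow, Heps1, !Cmod_R, (Rabs_pos_eq d), (Rabs_left (-2)) by lra.
      pose proof (Cmod_ge_0 m6). pose proof (Cmod_ge_0 (m4 - INR 0 * b 0%nat)%C). nra. }
    assert (HXle : Cmod (INR k * b k)%C <= Cmod X + Cmod e).
    { rewrite HX. unfold Cminus. rewrite <- (Cmod_opp e). apply Cmod_triangle. }
    rewrite Cmod_mult, Cmod_R, (Rabs_pos_eq _ (pos_INR k)) in HXle. fold B in HXle. lra. }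
  (* The choice of [eps] makes the limit the real number 1 + d^2 - d B. *)
  assert (HR : Re ((1 + d ^ 2) * m1 + (- (d * Cconj eps)) * m2 + (- (d * eps)) * m3)%C
     <= 1 + d ^ 2 - d * B + (1 + d ^ 2 + 2 * d) * eta).
  { set (e := ((1 + d ^ 2) * (m1 - 1) + (- (d * Cconj eps)) * (m2 - b k) + (- (d * eps)) * m3)%C).
    replace ((1 + d ^ 2) * m1 + (- (d * Cconj eps)) * m2 + (- (d * eps)) * m3)%C
      with (RtoC (1 + d ^ 2 - d * B) + e)%C.
    2: { rewrite RtoC_minus, RtoC_plus, RtoC_mult, <- Heps2, RtoC_pow. unfold e. ring. }
    rewrite re_plus, re_RtoC.
    assert (He : Cmod e <= (1 + d ^ 2 + 2 * d) * eta).
    { unfold e. eapply Rle_trans; [apply Cmod_triangle|].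
      eapply Rle_trans; [apply Rplus_le_compat_r, Cmod_triangle|].
      rewrite <- RtoC_pow, <- RtoC_plus, !Cmod_mult, !Cmod_opp, !Cmod_mult, Cmod_conj, Heps1, !Cmod_R.
      rewrite (Rabs_pos_eq d), (Rabs_pos_eq (1 + d ^ 2)) by nra.
      assert (0 <= d * d) by nra.
      assert ((1 + d ^ 2) * Cmod (m1 - 1)%C <= (1 + d ^ 2) * eta) by (apply Rmult_le_compat_l; [nra|easy]).
      nra. }
    pose proof (re_le_Cmod e) as HRe. pose proof (Rle_abs (Re e)). lra. }
  assert (HWeta : W * eta = gap / 2) by (unfold eta; field; lra).
  unfold W, gap in HWeta, Hgap. nra.
Qed.

(** * The series of z f(z) and the coefficient inequality in the class ME *)

Definition shifted_coef (a : nat -> C) (n : nat) : C :=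
  match n with O => 1%C | S m => a m end.

Lemma has_expansion_shifted (f : C -> C) (a : nat -> C) :
  has_expansion f a ->
  forall z, E z ->
    is_pseries (K := C_AbsRing) (V := C_NormedModule) (shifted_coef a) z (z * f z)%C.
Proof.
  intros H z Hz.
  assert (Hz0 : z <> 0%C) by (apply Cmod_gt_0; apply Hz).
  apply is_pseries_C.
  apply (is_series_decr_1 (K := C_AbsRing) (V := C_NormedModule) (fun n => shifted_coef a n * z ^ n)%C).
  change (is_series (K := C_AbsRing) (V := C_NormedModule)
    (fun k => a k * z ^ S k)%C (z * f z - 1 * 1)%C).
  replace (z * f z - 1 * 1)%C with (z * (f z - / z))%C by (field; easy).
  assert (H1 := is_series_scal (K := C_AbsRing) (V := C_NormedModule) z _ _
    (proj1 (is_pseries_C _ _ _) (H z Hz))).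
  eapply is_series_ext; [|exact H1].
  intros n. change (z * (a n * z ^ n) = a n * (z * z ^ n))%C. ring.
Qed.

(* The two module structures carry different, though equivalent, balls. *)
Lemma is_derive_AbsRing_C (f : C -> C) (z l : C) :
  is_derive (K := C_AbsRing) (V := AbsRing_NormedModule C_AbsRing) f z l <->
  is_derive (K := C_AbsRing) (V := C_NormedModule) f z l.
Proof. split; (intros [_ H]; split; [apply is_linear_scal_l|exact H]). Qed.

Lemma is_derive_C_mult (f g : C -> C) (z df dg : C) :
  is_derive (K := C_AbsRing) (V := C_NormedModule) f z df ->
  is_derive (K := C_AbsRing) (V := C_NormedModule) g z dg ->
  is_derive (K := C_AbsRing) (V := C_NormedModule) (fun y => f y * g y)%C z (df * g z + f z * dg)%C.
Proof.
  intros Hf Hg. apply is_derive_AbsRing_C in Hf, Hg. apply is_derive_AbsRing_C.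
  exact (is_derive_mult (K := C_AbsRing) f g z df dg Hf Hg Cmult_comm).
Qed.

Lemma is_derive_C_id (z : C) : is_derive (K := C_AbsRing) (V := C_NormedModule) (fun y => y) z (RtoC 1).
Proof. apply is_derive_AbsRing_C. exact (is_derive_id (K := C_AbsRing) z). Qed.

Lemma is_derive_C_unique (f : C -> C) (z l1 l2 : C) :
  is_derive (K := C_AbsRing) (V := C_NormedModule) f z l1 ->
  is_derive (K := C_AbsRing) (V := C_NormedModule) f z l2 -> l1 = l2.
Proof.
  intros H1 H2. apply is_C_derive_unique in H1, H2. congruence.
Qed.

(** With p(z) = z f(z), the product rule gives z^2 f' + z f = z p', and the operator z d/dz
    multiplies the n-th coefficient by n. *)
Lemma Sigma_euler_series (f : C -> C) (a : nat -> C) :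
  analytic_in_E f -> has_expansion f a ->
  forall z, E z ->
    is_pseries (K := C_AbsRing) (V := C_NormedModule) (fun n => INR n * shifted_coef a n)%C z
      (z ^ 2 * C_derive f z + z * f z)%C.
Proof.
  intros Hf Ha z Hz.
  destruct (is_pseries_C_derive _ _ (has_expansion_shifted f a Ha) z Hz) as [l [Hl Hs]].
  replace (z ^ 2 * C_derive f z + z * f z)%C with (z * l)%C; [exact Hs|].
  assert (Hd := is_derive_C_mult _ _ _ _ _ (is_derive_C_id z) (C_derive_correct f z z (Hf z Hz))).
  rewrite (is_derive_C_unique _ _ _ _ Hl Hd). ring.
Qed.

(** Let [r] tend to 1 along 1 - 1/(n+2), which lies in (0,1) already at n = 0. *)
Lemma le_of_mul_pow_le (x y : R) (k : nat) :
  (forall r, 0 < r < 1 -> x * r ^ k <= y) -> x <= y.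
Proof.
  intros H.
  assert (Hu : is_lim_seq (fun n => / (INR n + 2)) 0).
  { apply (is_lim_seq_ext (fun n => / INR (n + 2))).
    - intros n. now rewrite plus_INR.
    - apply -> (is_lim_seq_incr_n (fun n => / INR n) 2 0).
      now apply (is_lim_seq_inv INR p_infty is_lim_seq_INR). }
  assert (Hl : is_lim_seq (fun n => x * (1 - / (INR n + 2)) ^ k) (x * (1 - 0) ^ k)).
  { apply (is_lim_seq_scal_l _ x ((1 - 0) ^ k)).
    apply (is_lim_seq_continuous (fun t => (1 - t) ^ k) _ 0); [|exact Hu].
    apply derivable_continuous_pt. reg. }
  rewrite Rminus_0_r, pow1, Rmult_1_r in Hl.
  refine (is_lim_seq_le _ _ _ _ _ Hl (is_lim_seq_const y)).
  intros n. apply H. pose proof (pos_INR n).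
  assert (0 < / (INR n + 2)) by (apply Rinv_0_lt_compat; lra).
  assert (/ (INR n + 2) <= / 2) by (apply Rinv_le_contravar; lra). lra.
Qed.

(** On the circle of radius r < 1 the series converge absolutely, so the test inequality applies
    with coefficients c_m r^m at index n + 1, where c_(n+1) = a_n; then [r] tends to 1. *)
Lemma ME_coef_inequality (alpha d : R) (f : C -> C) (a : nat -> C) (n : nat) :
  0 <= alpha -> 0 <= d -> ME alpha f -> has_expansion f a ->
  Cmod (a n) * (alpha * (INR n + 1) + d) <= 1 + d ^ 2.
Proof.
  intros Halpha Hd [[Hf _] Hre] Ha.
  apply (le_of_mul_pow_le _ _ (S n)). intros r Hr.
  set (c := shifted_coef a).
  assert (HE : forall w, Cmod w = 1 -> E (r * w)%C).
  { intros w Hw. unfold E. rewrite Cmod_mult, Cmod_R, Hw, Rabs_pos_eq by lra. lra. }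
  assert (Hpow : forall w m, ((r * w) ^ m = r ^ m * w ^ m)%C) by (intros; apply Cpow_mult_l).
  assert (Hcv : Rbar_lt (Rabs r) (CV_radius (fun m => Cmod (c m)))).
  { apply (CV_radius_Cmod c _ (has_expansion_shifted f a Ha)). rewrite Rabs_pos_eq; lra. }
  assert (Hrm : forall m, 0 <= r ^ m) by (intros; apply pow_le; lra).
  assert (H : Cmod (c (S n) * r ^ S n)%C * (alpha * INR (S n) + d) <= 1 + d ^ 2).
  { apply (coef_test_inequality alpha d (fun m => c m * r ^ m)%C
       (fun w => (r * w) * f (r * w))%C
       (fun w => (r * w) ^ 2 * C_derive f (r * w) + (r * w) * f (r * w))%C (S n)); try easy; try lia.
    - unfold c. simpl. ring.
    - intros w Hw.
      eapply is_series_ext; [|exact (proj1 (is_pseries_C _ _ _) (has_expansion_shifted f a Ha _ (HE w Hw)))].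
      intros m. cbv beta. rewrite Hpow. apply Cmult_assoc.
    - intros w Hw.
      eapply is_series_ext; [|exact (proj1 (is_pseries_C _ _ _) (Sigma_euler_series f a Hf Ha _ (HE w Hw)))].
      intros m. cbv beta. rewrite Hpow. fold c.
      change (INR m * c m * (r ^ m * w ^ m) = INR m * (c m * r ^ m) * w ^ m)%C. ring.
    - eapply ex_series_ext; [|exact (CV_disk_inside _ _ Hcv)].
      intros m. cbv beta. rewrite Cmod_mult, <- RtoC_pow, Cmod_R, Rabs_mult, (Rabs_pos_eq (Cmod _)) by apply Cmod_ge_0.
      reflexivity.
    - eapply ex_series_ext; [|exact (ex_series_derive_weight _ _ Hcv)].
      intros m. cbv beta.
      rewrite !Cmod_mult, <- RtoC_pow, !Cmod_R, !Rabs_mult, (Rabs_pos_eq (Cmod _)) by apply Cmod_ge_0.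
      apply Rmult_assoc.
    - intros w Hw. left. now apply Hre, HE. }
  rewrite Cmod_mult, <- RtoC_pow, Cmod_R, Rabs_pos_eq, S_INR in H by easy.
  change (Cmod (a n) * r ^ S n * (alpha * (INR n + 1) + d) <= 1 + d ^ 2) in H. lra.
Qed.

(** * The number d_n and the coefficient bound *)

(** With x = alpha n and s = sqrt (x^2 + 1), one has (s - x)(s + x) = 1. *)
Lemma d_eq_quotient (alpha : R) (n : nat) : 0 <= alpha ->
  2 * d alpha n = 2 / (sqrt (alpha ^ 2 * INR n ^ 2 + 1) + alpha * INR n).
Proof.
  intros Ha. unfold d. set (x := alpha * INR n).
  replace (alpha ^ 2 * INR n ^ 2 + 1) with (x ^ 2 + 1) by (unfold x; ring).
  assert (Hx : 0 <= x) by (apply Rmult_le_pos; [easy|apply pos_INR]).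
  assert (Hs : 0 < sqrt (x ^ 2 + 1)) by (apply sqrt_lt_R0; nra).
  assert (Hs2 : sqrt (x ^ 2 + 1) * sqrt (x ^ 2 + 1) = x ^ 2 + 1) by (apply sqrt_sqrt; nra).
  set (s := sqrt (x ^ 2 + 1)) in *.
  replace 2 with (2 * ((s - x) * (s + x))) at 2 by nra.
  field. lra.
Qed.

(** This is the stationarity equation of (1 + t^2) / (alpha n + t), the bound furnished by the test
    inequality with parameter t. Equivalently, 1 + d^2 = 2 d (alpha n + d). *)
Lemma d_quadratic (alpha : R) (n : nat) :
  d alpha n ^ 2 + 2 * alpha * INR n * d alpha n = 1.
Proof.
  unfold d. set (x := alpha * INR n).
  replace (alpha ^ 2 * INR n ^ 2 + 1) with (x ^ 2 + 1) by (unfold x; ring).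
  assert (Hs2 : sqrt (x ^ 2 + 1) * sqrt (x ^ 2 + 1) = x ^ 2 + 1) by (apply sqrt_sqrt; nra).
  set (s := sqrt (x ^ 2 + 1)) in *.
  replace (2 * alpha * INR n) with (2 * x) by (unfold x; ring). nra.
Qed.

Lemma d_pos (alpha : R) (n : nat) : 0 <= alpha -> 0 < d alpha n.
Proof.
  intros Ha. unfold d. set (x := alpha * INR n).
  replace (alpha ^ 2 * INR n ^ 2 + 1) with (x ^ 2 + 1) by (unfold x; ring).
  assert (Hx : 0 <= x) by (apply Rmult_le_pos; [easy|apply pos_INR]).
  assert (x < sqrt (x ^ 2 + 1)); [|lra].
  rewrite <- (sqrt_pow2 x) at 1 by easy. apply sqrt_lt_1_alt. nra.
Qed.

Lemma coef_bound_d (alpha : R) (n : nat) : 0 <= alpha -> coef_bound alpha n = 2 * d alpha (S n).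
Proof. intros Ha. rewrite d_eq_quotient, S_INR by easy. reflexivity. Qed.

Lemma ME_coef_bound (alpha : R) (f : C -> C) (a : nat -> C) (n : nat) :
  0 <= alpha -> ME alpha f -> has_expansion f a -> Cmod (a n) <= coef_bound alpha n.
Proof.
  intros Halpha Hf Ha. rewrite coef_bound_d by easy.
  pose proof (d_pos alpha (S n) Halpha) as Hd.
  pose proof (d_quadratic alpha (S n)) as Hq.
  pose proof (ME_coef_inequality alpha (d alpha (S n)) f a n Halpha ltac:(lra) Hf Ha) as H.
  rewrite S_INR in Hq. set (k := INR n + 1) in *. set (D := d alpha (S n)) in *.
  assert (Hk : 0 <= alpha * k) by (apply Rmult_le_pos; [easy|unfold k; pose proof (pos_INR n); lra]).
  (* Since 1 + D^2 = 2 D (alpha k + D), the factor alpha k + D cancels. *)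
  apply Rmult_le_reg_r with (alpha * k + D); [lra|]. nra.
Qed.

(** * Uniqueness of the expansion *)

(** On |z| = 1/2 the difference of the two series is the zero function, whose means all vanish; yet
    they approximate (a_n - b_n) / 2^n. *)
Lemma has_expansion_unique (f : C -> C) (a b : nat -> C) (n : nat) :
  has_expansion f a -> has_expansion f b -> a n = b n.
Proof.
  intros Ha Hb.
  set (r := / 2).
  pose (e := fun m => ((a m - b m) * r ^ m)%C).
  assert (HE : forall w, Cmod w = 1 -> E (r * w)%C).
  { intros w Hw. unfold E, r. rewrite Cmod_mult, Cmod_R, Hw, Rabs_pos_eq by lra. lra. }
  assert (Hs : forall w, Cmod w = 1 ->
    is_series (K := C_AbsRing) (V := C_NormedModule) (fun m => e m * w ^ m)%C (RtoC 0)).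
  { intros w Hw.
    assert (H := is_series_minus (K := C_AbsRing) (V := C_NormedModule) _ _ _ _
      (proj1 (is_pseries_C _ _ _) (Ha _ (HE w Hw))) (proj1 (is_pseries_C _ _ _) (Hb _ (HE w Hw)))).
    change (is_series (K := C_AbsRing) (V := C_NormedModule)
      (fun m => a m * (r * w) ^ m - b m * (r * w) ^ m)%C
       ((f (r * w) - / (r * w)) - (f (r * w) - / (r * w)))%C) in H.
    replace ((f (r * w) - / (r * w)) - (f (r * w) - / (r * w)))%C with (RtoC 0) in H by ring.
    eapply is_series_ext; [|exact H].
    intros m. cbv beta. unfold e. rewrite Cpow_mult_l.
    change (a m * (r ^ m * w ^ m) - b m * (r ^ m * w ^ m) = (a m - b m) * r ^ m * w ^ m)%C. ring. }
  assert (Hex : ex_series (fun m => Cmod (e m))).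
  { assert (Hcv : forall a, has_expansion f a -> ex_series (fun m => Rabs (Cmod (a m) * r ^ m))).
    { intros a' Ha'. apply CV_disk_inside. apply (CV_radius_Cmod a' _ Ha').
      unfold r. rewrite Rabs_pos_eq; lra. }
    apply (ex_series_le (V := R_CompleteNormedModule) _
      (fun m => Rabs (Cmod (a m) * r ^ m) + Rabs (Cmod (b m) * r ^ m))).
    - intros m. change (norm (Cmod (e m))) with (Rabs (Cmod (e m))).
      rewrite (Rabs_pos_eq (Cmod _)) by apply Cmod_ge_0.
      unfold e. rewrite Cmod_mult, <- RtoC_pow, Cmod_R, !Rabs_mult, !(Rabs_pos_eq (Cmod _)) by apply Cmod_ge_0.
      rewrite <- Rmult_plus_distr_r. apply Rmult_le_compat_r; [apply Rabs_pos|].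
      rewrite <- (Cmod_opp (b m)). apply Cmod_triangle.
    - exact (ex_series_plus (V := R_NormedModule) _ _ (Hcv a Ha) (Hcv b Hb)). }
  assert (He : Cmod (e n) <= 0).
  { apply Rnot_lt_le. intros Hlt.
    destruct (mean_series_coef e (fun _ => 0%C) n Hs Hex (Cmod (e n) / 2)) as [N HN]; [lra|].
    specialize (HN N (le_n N)).
    rewrite (mean_ext N _ (fun _ => 0%C)), mean_const in HN by (intros; ring).
    replace (0 - e n)%C with (- e n)%C in HN by ring. rewrite Cmod_opp in HN. lra. }
  assert (He0 : e n = 0%C) by (apply Cmod_eq_0; pose proof (Cmod_ge_0 (e n)); lra).
  assert (Hr : (RtoC r ^ n)%C <> 0%C).
  { apply Cpow_nz. intros H. apply RtoC_inj in H. unfold r in H. lra. }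
  unfold e in He0.
  replace (a n) with ((a n - b n) * r ^ n / r ^ n + b n)%C by (field; easy).
  rewrite He0. field; easy.
Qed.

(** * The extremal function *)

(** Read off from (1 + q)/(1 - q) = 1 + 2 (q + q^2 + ...) with q = D z^n. Division by z turns the
    exponent [S j] into [j]. *)
Definition extremal_coef (D : R) (n j : nat) : C :=
  if Nat.eq_dec (S j mod n) 0 then RtoC (2 * D ^ (S j / n)) else 0%C.

Lemma extremal_coef_first (D : R) (n : nat) : (1 <= n)%nat ->
  extremal_coef D n (n - 1) = RtoC (2 * D).
Proof.
  intros Hn. unfold extremal_coef. replace (S (n - 1)) with n by lia.
  rewrite Nat.Div0.mod_same, Nat.div_same by lia. simpl. f_equal; ring.
Qed.

Lemma extremal_coef_small (D : R) (n j : nat) : (S j < n)%nat -> extremal_coef D n j = 0%C.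
Proof.
  intros Hj. unfold extremal_coef. rewrite Nat.mod_small by easy. reflexivity.
Qed.

Lemma extremal_coef_shift (D : R) (n j : nat) : (1 <= n)%nat ->
  extremal_coef D n (n + j) = (D * extremal_coef D n j)%C.
Proof.
  intros Hn. unfold extremal_coef.
  replace (S (n + j)) with (S j + 1 * n)%nat by lia.
  rewrite Nat.Div0.mod_add, Nat.div_add by lia.
  destruct (Nat.eq_dec _ _); [|ring].
  rewrite <- RtoC_mult. f_equal. rewrite Nat.add_1_r. simpl. ring.
Qed.

Lemma extremal_coef_bound (D : R) (n j : nat) : 0 <= D <= 1 -> Cmod (extremal_coef D n j) <= 2.
Proof.
  intros HD. unfold extremal_coef. destruct (Nat.eq_dec _ _).
  - rewrite Cmod_R. assert (0 <= D ^ (S j / n)) by (apply pow_le; lra).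
    assert (D ^ (S j / n) <= 1) by (rewrite <- (pow1 (S j / n)); apply pow_incr; lra).
    rewrite Rabs_pos_eq; lra.
  - rewrite Cmod_0. lra.
Qed.

Lemma Cmod_lt_1_neq_1 (q : C) : Cmod q < 1 -> (1 - q)%C <> 0%C.
Proof.
  intros Hq H. replace q with (1 - (1 - q))%C in Hq by ring. rewrite H in Hq.
  replace (1 - 0)%C with (RtoC 1) in Hq by ring. rewrite Cmod_1 in Hq. lra.
Qed.

Lemma Cmod_extremal_arg (D : R) (n : nat) (z : C) : (1 <= n)%nat -> 0 < D <= 1 -> E z ->
  Cmod (D * z ^ n)%C < D.
Proof.
  intros Hn HD Hz. rewrite Cmod_mult, Cmod_R, Cmod_pow, Rabs_pos_eq by lra.
  assert (Cmod z ^ n < 1).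
  { destruct n as [|n]; [lia|]. destruct Hz. simpl.
    assert (0 <= Cmod z ^ n) by (apply pow_le; lra).
    assert (Cmod z ^ n <= 1) by (rewrite <- (pow1 n); apply pow_incr; lra). nra. }
  nra.
Qed.

(* The sum [S] of the series satisfies [S = 2 D z^(n-1) + D z^n S]. *)
Lemma extremal_expansion (D : R) (n : nat) (f : C -> C) : (1 <= n)%nat -> 0 < D <= 1 ->
  (forall z, E z -> (z * f z = (1 + D * z ^ n) / (1 - D * z ^ n))%C) ->
  has_expansion f (extremal_coef D n).
Proof.
  intros Hn HD Hf z Hz.
  assert (Hz0 : z <> 0%C) by (apply Cmod_gt_0; apply Hz).
  assert (Hq1 : (1 - D * z ^ n)%C <> 0%C).
  { apply Cmod_lt_1_neq_1. pose proof (Cmod_extremal_arg D n z Hn HD Hz). lra. }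
  apply is_pseries_C.
  pose (u := fun j => (extremal_coef D n j * z ^ j)%C).
  (* Comparison with 2 |z|^j, since the coefficients are at most 2 in modulus. *)
  assert (Hex : exists l : C, is_series (K := C_AbsRing) (V := C_NormedModule) u l).
  { apply (ex_series_le (K := C_AbsRing) (V := C_CompleteNormedModule) u (fun j => 2 * Cmod z ^ j)).
    - intros j. change (norm (u j)) with (Cmod (u j)). unfold u. rewrite Cmod_mult, Cmod_pow.
      apply Rmult_le_compat_r; [apply pow_le, Cmod_ge_0|]. apply extremal_coef_bound; lra.
    - apply (ex_series_scal (V := R_NormedModule) 2). apply ex_series_geom.
      rewrite Rabs_pos_eq by apply Cmod_ge_0. apply Hz. }
  destruct Hex as [l Hl].
  replace (f z - / z)%C with l; [exact Hl|].
  assert (Hsum : sum_n (G := C_AbelianMonoid) u (n - 1) = (2 * D * z ^ (n - 1))%C).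
  { assert (Hlow : forall m, (S m < n)%nat -> sum_n (G := C_AbelianMonoid) u m = RtoC 0).
    { induction m as [|m IH]; intros Hm.
      - rewrite sum_O. unfold u. rewrite extremal_coef_small by easy. apply Cmult_0_l.
      - rewrite sum_Sn, IH by lia. unfold u. rewrite extremal_coef_small by easy.
        rewrite Cmult_0_l. apply Cplus_0_l. }
    assert (Hlast : u (n - 1)%nat = (2 * D * z ^ (n - 1))%C)
      by (unfold u; rewrite extremal_coef_first by easy; now rewrite RtoC_mult).
    destruct n as [|[|m]]; [lia| |].
    - rewrite sum_O. exact Hlast.
    - replace (S (S m) - 1)%nat with (S m) in * by lia.
      rewrite sum_Sn, Hlow, Hlast by lia. apply Cplus_0_l. }
  assert (Htail : is_series (K := C_AbsRing) (V := C_NormedModule) (fun k => u (n + k)%nat)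
                    (l - 2 * D * z ^ (n - 1))%C).
  { apply (is_series_incr_n (K := C_AbsRing) (V := C_NormedModule) u n); [lia|].
    replace (Nat.pred n) with (n - 1)%nat by lia.
    change (is_series (K := C_AbsRing) (V := C_NormedModule) u
       (l - 2 * D * z ^ (n - 1) + sum_n (G := C_AbelianMonoid) u (n - 1))%C).
    rewrite Hsum.
    change (is_series (K := C_AbsRing) (V := C_NormedModule) u
       (l - 2 * D * z ^ (n - 1) + 2 * D * z ^ (n - 1))%C).
    replace (l - 2 * D * z ^ (n - 1) + 2 * D * z ^ (n - 1))%C with l by ring. exact Hl. }
  assert (Heq : (l - 2 * D * z ^ (n - 1))%C = (D * z ^ n * l)%C).
  { refine (is_series_C_unique _ _ _ Htail _).
    eapply is_series_ext;
      [|exact (is_series_scal (K := C_AbsRing) (V := C_NormedModule) (D * z ^ n)%C _ _ Hl)].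
    intros j. unfold u. rewrite extremal_coef_shift, Cpow_add_r by easy.
    change (D * z ^ n * (extremal_coef D n j * z ^ j)
      = D * extremal_coef D n j * (z ^ n * z ^ j))%C. ring. }
  assert (Hzn : (z ^ n = z * z ^ (n - 1))%C) by (rewrite <- Cpow_S; f_equal; lia).
  replace (f z - / z)%C with ((z * f z - 1) / z)%C by (field; easy).
  rewrite Hf by easy.
  replace l with ((l - D * z ^ n * l) / (1 - D * z ^ n))%C by (field; easy).
  rewrite <- Heq.
  set (q := (z ^ n)%C) in *.
  replace (l - (l - 2 * D * z ^ (n - 1)))%C with (2 * D * q / z)%C by (rewrite Hzn; field; easy).
  field. easy.
Qed.

(** The remainder is exactly (y - z)^2 / (y z^2), and |y| >= |z| / 2 for [y] near [z]. *)
Lemma is_derive_C_inv (z : C) : z <> 0%C ->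
  is_derive (K := C_AbsRing) (V := C_NormedModule) Cinv z (- / (z * z))%C.
Proof.
  intros Hz. assert (Hz0 : 0 < Cmod z) by now apply Cmod_gt_0.
  apply is_derive_C_quadratic with (2 / (Cmod z * Cmod z * Cmod z)) (Cmod z / 2); [lra|].
  intros y Hy.
  assert (Hy1 : Cmod z / 2 <= Cmod y).
  { pose proof (Cmod_triangle y (z - y)) as Ht.
    replace (y + (z - y))%C with z in Ht by ring.
    replace (z - y)%C with (- (y - z))%C in Ht by ring. rewrite Cmod_opp in Ht. lra. }
  assert (Hy0 : y <> 0%C) by (apply Cmod_gt_0; lra).
  replace (/ y - / z - (y - z) * - / (z * z))%C with ((y - z) * (y - z) / (y * (z * z)))%C by (field; easy).
  rewrite Cmod_div, !Cmod_mult by (repeat apply Cmult_neq_0; easy).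
  replace (2 / (Cmod z * Cmod z * Cmod z) * Cmod (y - z) ^ 2)
    with (Cmod (y - z) * Cmod (y - z) / (Cmod z / 2 * (Cmod z * Cmod z))) by (field; lra).
  apply Rmult_le_compat_l; [apply Rmult_le_pos; apply Cmod_ge_0|].
  apply Rinv_le_contravar.
  - repeat apply Rmult_lt_0_compat; lra.
  - apply Rmult_le_compat_r; [|easy]. apply Rmult_le_pos; lra.
Qed.

Lemma locally_E (z : C) : E z -> locally (T := AbsRing_UniformSpace C_AbsRing) z E.
Proof.
  intros Hz. destruct Hz as [Hz1 Hz2].
  assert (Hd : 0 < Rmin (Cmod z) (1 - Cmod z)) by (apply Rmin_pos; lra).
  assert (Hball : forall y : C, Cmod (y - z) < Rmin (Cmod z) (1 - Cmod z) -> E y).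
  { intros y Hy.
    pose proof (Rmin_l (Cmod z) (1 - Cmod z)). pose proof (Rmin_r (Cmod z) (1 - Cmod z)).
    pose proof (Cmod_triangle y (z - y)) as Ht.
    replace (y + (z - y))%C with z in Ht by ring.
    replace (z - y)%C with (- (y - z))%C in Ht by ring. rewrite Cmod_opp in Ht.
    pose proof (Cmod_triangle (y - z) z) as Ht2.
    replace (y - z + z)%C with y in Ht2 by ring.
    split; lra. }
  exists (mkposreal _ Hd). exact Hball.
Qed.

(** Near [z], f(y) is the product of y f(y), a power series, and 1/y. *)
Lemma expansion_analytic (f : C -> C) (a : nat -> C) : has_expansion f a -> analytic_in_E f.
Proof.
  intros Ha z Hz.
  destruct (is_pseries_C_derive _ _ (has_expansion_shifted f a Ha) z Hz) as [l [Hl _]].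
  assert (Hz0 : z <> 0%C) by (apply Cmod_gt_0; apply Hz).
  eexists.
  apply (is_derive_ext_loc (K := C_AbsRing) (V := C_NormedModule) (fun y => y * f y * / y)%C).
  - refine (filter_imp E _ _ (locally_E z Hz)). intros y Hy.
    assert (Hy0 : y <> 0%C) by (apply Cmod_gt_0; apply Hy).
    change (y * f y * / y = f y)%C. field; easy.
  - apply is_derive_C_mult; [exact Hl|now apply is_derive_C_inv].
Qed.

Lemma is_derive_C_pow (z : C) (n : nat) :
  is_derive (K := C_AbsRing) (V := C_NormedModule) (fun y => y ^ n)%C z (INR n * z ^ (n - 1))%C.
Proof.
  induction n as [|n IH].
  - replace (INR 0 * z ^ (0 - 1))%C with (RtoC 0) by (simpl; ring).
    exact (is_derive_const (K := C_AbsRing) (V := C_NormedModule) (RtoC 1) z).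
  - replace (INR (S n) * z ^ (S n - 1))%C with (1 * z ^ n + z * (INR n * z ^ (n - 1)))%C.
    + exact (is_derive_C_mult _ _ _ _ _ (is_derive_C_id z) IH).
    + rewrite S_INR, RtoC_plus. replace (S n - 1)%nat with n by lia.
      destruct n as [|n]; [simpl; ring|].
      replace (S n - 1)%nat with n by lia. rewrite Cpow_S. ring.
Qed.

Lemma is_derive_C_affine_pow (a b z : C) (n : nat) :
  is_derive (K := C_AbsRing) (V := C_NormedModule) (fun y => a + b * y ^ n)%C z
    (b * (INR n * z ^ (n - 1)))%C.
Proof.
  replace (b * (INR n * z ^ (n - 1)))%C with (0 + (0 * z ^ n + b * (INR n * z ^ (n - 1))))%C by ring.
  apply (is_derive_plus (K := C_AbsRing) (V := C_NormedModule) (fun _ => a) (fun y => b * y ^ n)%C).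
  - exact (is_derive_const (K := C_AbsRing) (V := C_NormedModule) a z).
  - apply (is_derive_C_mult (fun _ => b) (fun y => y ^ n)%C).
    + exact (is_derive_const (K := C_AbsRing) (V := C_NormedModule) b z).
    + apply is_derive_C_pow.
Qed.

(** After multiplying by the conjugate of the denominator, the numerator (1 + q)(1 - conj q) has
    real part 1 - |q|^2. *)
Lemma Re_cayley (q : C) : (1 - q)%C <> 0%C ->
  Re ((1 + q) / (1 - q))%C = (1 - Cmod q ^ 2) / Cmod (1 - q) ^ 2.
Proof.
  intros Hq.
  assert (Hm : Cmod (1 - q) ^ 2 <> 0).
  { apply pow_nonzero. apply Rgt_not_eq. now apply Cmod_gt_0. }
  rewrite !Cmod2_alt in *.
  destruct q as [x y]. simpl in *. field. intros H; apply Hm. lra.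
Qed.

(** With q = D z^n, the condition reduces to 1 - |q|^2 > 2 alpha n |q| after multiplication by |1 -
    q|^2. It holds because |q| < D and D is the positive root of t^2 + 2 alpha n t = 1. *)
Lemma extremal_ME (alpha : R) (n : nat) (f : C -> C) : 0 <= alpha -> (1 <= n)%nat ->
  (forall z, E z -> (z * f z = (1 + d alpha n * z ^ n) / (1 - d alpha n * z ^ n))%C) ->
  ME alpha f.
Proof.
  intros Halpha Hn Hf.
  set (D := d alpha n) in *.
  pose proof (d_pos alpha n Halpha) as HD0. pose proof (d_quadratic alpha n) as Hquad.
  fold D in HD0, Hquad.
  assert (Hx : 0 <= alpha * INR n) by (apply Rmult_le_pos; [easy|apply pos_INR]).
  assert (HD : 0 < D <= 1) by nra.
  assert (Hexp := extremal_expansion D n f Hn HD Hf).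
  assert (Han := expansion_analytic f _ Hexp).
  split; [split; [exact Han|eexists; exact Hexp]|].
  intros z Hz.
  assert (Hz0 : z <> 0%C) by (apply Cmod_gt_0; apply Hz).
  pose proof (Cmod_extremal_arg D n z Hn HD Hz) as Hq.
  assert (Hq1 : (1 - D * z ^ n)%C <> 0%C) by (apply Cmod_lt_1_neq_1; lra).
  assert (Heuler : (z ^ 2 * C_derive f z + z * f z
     = 2 * INR n * (D * z ^ n) / (1 - D * z ^ n) ^ 2)%C).
  (* The derivative comes from differentiating p (1 - q) = 1 + q, an identity valid near [z], and
     solving for p'. *)
  { assert (Hp := is_derive_C_mult _ _ _ _ _ (is_derive_C_id z) (C_derive_correct f z z (Han z Hz))).
    assert (Hl := is_derive_C_mult _ _ _ _ _ Hp (is_derive_C_affine_pow 1 (- D) z n)).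
    assert (Hr : is_derive (K := C_AbsRing) (V := C_NormedModule)
      (fun y => y * f y * (1 + - D * y ^ n))%C z (D * (INR n * z ^ (n - 1)))%C).
    { apply (is_derive_ext_loc (K := C_AbsRing) (V := C_NormedModule) (fun y => 1 + D * y ^ n)%C);
        [|apply is_derive_C_affine_pow].
      refine (filter_imp E _ _ (locally_E z Hz)). intros y Hy.
      assert (Hy1 : (1 - D * y ^ n)%C <> 0%C).
      { apply Cmod_lt_1_neq_1. pose proof (Cmod_extremal_arg D n y Hn HD Hy). lra. }
      change (1 + D * y ^ n = y * f y * (1 + - D * y ^ n))%C.
      rewrite Hf by easy. field; easy. }
    assert (Heq := is_derive_C_unique _ _ _ _ Hl Hr).
    cbv beta in Heq. rewrite Hf in Heq by easy.
    assert (Hzn : (z ^ n = z * z ^ (n - 1))%C) by (rewrite <- Cpow_S; f_equal; lia).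
    set (P := (1 * f z + z * C_derive f z)%C) in *.
    replace (z ^ 2 * C_derive f z + z * f z)%C with (z * P)%C by (unfold P; ring).
    set (q := (D * z ^ n)%C) in *.
    set (Q := (D * (INR n * z ^ (n - 1)))%C) in *.
    assert (HQ : (z * Q)%C = (INR n * q)%C) by (unfold Q, q; rewrite Hzn; ring).
    assert (HP : P = (Q * (1 + (1 + q) / (1 - q)) / (1 - q))%C).
    { replace P with (P * (1 + - D * z ^ n) / (1 - q))%C by (unfold q in *; field; easy).
      replace (P * (1 + - D * z ^ n))%C with (Q + (1 + q) / (1 - q) * Q)%C.
      - field; easy.
      - rewrite <- Heq at 1. unfold Q. ring. }
    rewrite HP. replace (2 * INR n * q)%C with (2 * (z * Q))%C by (rewrite HQ; ring).
    field; easy. }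
  rewrite Heuler, Hf, Re_cayley by easy.
  rewrite Cmod_div, Cmod_pow, !Cmod_mult, !Cmod_R by now apply Cpow_nz.
  rewrite <- (Cmod_R D), <- Cmod_mult, (Rabs_pos_eq 2), (Rabs_pos_eq (INR n)) by (try apply pos_INR; lra).
  set (q := (D * z ^ n)%C) in *.
  assert (Hm : 0 < Cmod (1 - q)) by now apply Cmod_gt_0.
  unfold Rdiv. rewrite <- !Rmult_assoc. apply Rmult_lt_compat_r.
  - apply Rinv_0_lt_compat. now apply pow_lt.
  - pose proof (Cmod_ge_0 q). nra.
Qed.

Theorem theorem2p3 (alpha : R) (Halpha : (0 <= alpha)%R) :
  (forall (f : C -> C) (a : nat -> C),
     ME alpha f -> has_expansion f a ->
     forall n : nat, (Cmod (a n) <= coef_bound alpha n)%R)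
  /\
  (forall n : nat, (1 <= n)%nat ->
   forall f : C -> C,
     (forall z : C, E z ->
        (z * f z = (1 + RtoC (d alpha n) * z ^ n)
                   / (1 - RtoC (d alpha n) * z ^ n))%C) ->
     ME alpha f /\
     forall a : nat -> C, has_expansion f a ->
       Cmod (a (n - 1)%nat) = coef_bound alpha (n - 1)).
Proof.
  split.
  - intros f a Hf Ha n. now apply ME_coef_bound with f.
  - intros n Hn f Hf. split; [now apply extremal_ME with n|].
    intros a Ha.
    pose proof (d_pos alpha n Halpha) as Hd0. pose proof (d_quadratic alpha n) as Hq.
    assert (Hx : 0 <= alpha * INR n) by (apply Rmult_le_pos; [easy|apply pos_INR]).
    (* By uniqueness the given expansion may be replaced by the explicit one, whose coefficient at n
       - 1 is 2 d_n. *)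
    rewrite (has_expansion_unique f a (extremal_coef (d alpha n) n) (n - 1) Ha).
    + rewrite extremal_coef_first, coef_bound_d, Cmod_R by easy.
      replace (S (n - 1)) with n by lia. rewrite Rabs_pos_eq; lra.
    + apply extremal_expansion; [easy|nra|exact Hf].
Qed.
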